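(* For every $n\ge 1$, the semigroup $\mathrm{Dom}_{T_n}(C_n)$ is regular.
   Context: $X_n=\{1,2,\dots,n\}$ is the finite chain with its usual order, and $T_n$ is the full transformation semigroup of all maps $X_n\to X_n$, written on the right and composed left to right. The Catalan monoid $C_n$ is the subsemigroup of $T_n$ of all maps $\alpha$ that are both order-decreasing ($x\alpha\le x$ for all $x\in X_n$) and order-preserving ($x\le y\Rightarrow x\alpha\le y\alpha$ for all $x,y\in X_n$). For a subsemigroup $U$ of a semigroup $S$, an element $d\in S$ is dominated by $U$ if for every semigroup $T$ and all semigroup homomorphisms $f,g:S\to T$ with $f|_U=g|_U$ one has $(d)f=(d)g$; the dominion $\mathrm{Dom}_S(U)$ is the set of all elements of $S$ dominated by $U$ (a subsemigroup of $S$ containing $U$). A semigroup $S$ is regular if for every $a\in S$ there is $b\in S$ with $aba=a$. *)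

(* Defs.v *)
From HB Require Import structures.
From mathcomp Require Import all_boot.

Set Implicit Arguments.
Unset Strict Implicit.
Unset Printing Implicit Defensive.

Local Open Scope group_scope.

Section Dominion.
Variables (S : semigroupType) (U : S -> Prop).

(* The target T is a magma with an associativity hypothesis rather than a
   [semigroupType] because the latter carries a choice structure, and T must
   range over all semigroups. *)
Definition dominion (d : S) : Prop :=
  forall T : magmaType, associative (@mul T) ->
  forall f g : {multiplicative S -> T},
    (forall u, U u -> f u = g u) -> f d = g d.

Lemma sub_dominion u : U u -> dominion u.
Proof. by move=> Uu T _ f g; apply. Qed.

Lemma dominionM a b : dominion a -> dominion b -> dominion (a * b).
Proof.
move=> Da Db T mulTA f g efg.
by rewrite !gmulfM (Da T mulTA f g efg) (Db T mulTA f g efg).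
Qed.

End Dominion.

(* Regularity of the subsemigroup D as a semigroup in its own right: the
   witness b is required to lie in D. *)
Definition regular_subsemigroup (S : semigroupType) (D : S -> Prop) : Prop :=
  forall a, D a -> exists2 b, D b & a * b * a = a.

(* The chain {1, ..., n} is represented by 'I_n = {0, ..., n-1}. [transf n] is
   an alias of {ffun 'I_n -> 'I_n}, so that composition does not compete with
   the pointwise product that finite functions carry in the library. *)
Definition transf (n : nat) : Type := {ffun 'I_n -> 'I_n}.

HB.instance Definition _ n := Finite.on (transf n).

(* Maps act on the right, so a product applies its left factor first. *)
Definition transf_mul n (a b : transf n) : transf n := [ffun x => b (a x)].

Lemma transf_mulA n : associative (@transf_mul n).
Proof. by move=> a b c; apply/ffunP=> x; rewrite !ffunE. Qed.

HB.instance Definition _ n := isSemigroup.Build (transf n) (@transf_mulA n).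

Lemma transf_mulE n (a b : transf n) (x : 'I_n) : (a * b) x = b (a x).
Proof. by rewrite /mul/= ffunE. Qed.

Definition order_decreasing n (a : transf n) : Prop :=
  forall x : 'I_n, (a x <= x)%N.

Definition order_preserving n (a : transf n) : Prop :=
  forall x y : 'I_n, (x <= y)%N -> (a x <= a y)%N.

Definition catalan n (a : transf n) : Prop :=
  order_decreasing a /\ order_preserving a.

Lemma catalanM n (a b : transf n) : catalan a -> catalan b -> catalan (a * b).
Proof.
move=> [da pa] [db pb]; split=> [x|x y lexy]; rewrite !transf_mulE.
  exact: leq_trans (db _) (da _).
exact/pb/pa.
Qed.

(* Main.v *)
(** The dominion of C_n consists of the order-preserving maps that fix the
    least point, and this semigroup is regular: the lower adjoint of such a map
    is an inverse of it lying in the same semigroup.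

    Upper bound: dominated maps preserve every operation on X_n that is
    preserved by C_n, in particular the constant operation at the least point
    and the minimum. If an operation [m] is preserved by U, then s |-> (s, 0)
    and s |-> (s, s.m - m.s) are homomorphisms to a split extension of S which
    agree on U, and they agree at [d] only if [d] preserves [m].

    Lower bound: d is the product of x |-> max(x, xd) and x |-> min(x, xd), the
    latter being in C_n. An extensive order-preserving map b fixing the least
    point has a lower adjoint l and an upper adjoint r, both in C_n, and so are
    bl and rb; then b = bl b = b rb is a zigzag showing that b is dominated. *)

Require Import Defs.
From HB Require Import structures.
From mathcomp Require Import all_boot.
From mathcomp Require Import zify.

Set Implicit Arguments.
Unset Strict Implicit.
Unset Printing Implicit Defensive.

Local Open Scope group_scope.

(* Pairs in S * (Z -> F_2), where the functions on the S-biact Z form an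
   S-bimodule of which the second component is a square-zero ideal. *)
Definition split_ext (S : semigroupType) (Z : finType) (L R : S -> Z -> Z) :
  Type := (S * {ffun Z -> bool})%type.

Definition split_ext_mul (S : semigroupType) (Z : finType)
    (L R : S -> Z -> Z) (p q : split_ext L R) : split_ext L R :=
  (p.1 * q.1, [ffun z => p.2 (R q.1 z) (+) q.2 (L p.1 z)]).

HB.instance Definition _ (S : semigroupType) (Z : finType)
    (L R : S -> Z -> Z) :=
  hasMul.Build (split_ext L R) (@split_ext_mul S Z L R).

Lemma dominion_biact (S : semigroupType) (U : S -> Prop) (Z : finType)
    (L R : S -> Z -> Z) (m : Z -> bool) :
  (forall s t z, L (s * t) z = L t (L s z)) ->
  (forall s t z, R (s * t) z = R s (R t z)) ->
  (forall s t z, L s (R t z) = R t (L s z)) ->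
  (forall u, U u -> forall z, m (L u z) = m (R u z)) ->
  forall d, dominion U d -> forall z, m (L d z) = m (R d z).
Proof.
move=> LM RM LR mU d domd z.
have mulTA : associative (@mul (split_ext L R)).
  move=> [s a] [t b] [r c]; rewrite /mul /= /split_ext_mul /= mulgA.
  by congr pair; apply/ffunP=> y; rewrite !ffunE RM LM LR addbA.
pose f s : split_ext L R := (s, [ffun=> false]).
pose g s : split_ext L R := (s, [ffun y => m (L s y) (+) m (R s y)]).
have fM : {morph f : s t / s * t}.
  move=> s t; rewrite /f /mul /= /split_ext_mul /=.
  by congr pair; apply/ffunP=> y; rewrite !ffunE.
have gM : {morph g : s t / s * t}.
  move=> s t; rewrite /g /mul /= /split_ext_mul /=.
  (* The mixed term [m (R t (L s y))] occurs twice and cancels modulo 2. *)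
  congr pair; apply/ffunP=> y; rewrite !ffunE RM LM LR.
  by do 4!case: (m _).
pose f' : {multiplicative S -> split_ext L R} :=
  HB.pack f (isMultiplicative.Build _ _ f fM).
pose g' : {multiplicative S -> split_ext L R} :=
  HB.pack g (isMultiplicative.Build _ _ g gM).
have /(congr1 snd)/ffunP/(_ z) : f' d = g' d.
  apply: domd => // u Uu; rewrite /= /f /g.
  by congr pair; apply/ffunP=> y; rewrite !ffunE mU ?addbb.
by rewrite !ffunE; do 2!case: (m _).
Qed.

Lemma dominion_binop n (U : transf n -> Prop) (phi : 'I_n -> 'I_n -> 'I_n) :
  (forall u : transf n, U u -> {morph u : x y / phi x y}) ->
  forall d : transf n, dominion U d -> {morph d : x y / phi x y}.
Proof.
move=> phiU d domd x y.
(* The biact is X * X * (X -> F_2); a point of its last factor tests the value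
   of phi, contravariantly so that it carries the action on the other side. *)
pose Z : finType := ('I_n * 'I_n * {ffun 'I_n -> bool})%type.
pose L (s : transf n) (z : Z) : Z := (s z.1.1, s z.1.2, z.2).
pose R (s : transf n) (z : Z) : Z := (z.1, [ffun w => z.2 (s w)]).
pose m (z : Z) := z.2 (phi z.1.1 z.1.2).
have mE z : m (L d z) = m (R d z).
  apply: dominion_biact domd z => // [s t z|s t z|u Uu z].
  - by rewrite /L /= !transf_mulE.
  - by rewrite /R /=; congr pair; apply/ffunP=> w; rewrite !ffunE.
  - by rewrite /m /= ffunE (phiU u).
(* Testing with the indicator of one point turns [mE] into an equality of values. *)
have /esym := mE (x, y, [ffun w => w == phi (d x) (d y)]).
by rewrite /m /= !ffunE eqxx => /eqP.
Qed.

Lemma dominion_zigzag (S : semigroupType) (U : S -> Prop) (b l r : S) :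
  U l -> U r -> U (b * l) -> U (r * b) -> b * l * b = b -> b * r * b = b ->
  dominion U b.
Proof.
move=> Ul Ur Ubl Urb blb brb T mulTA f g efg.
have fb : f b = f (b * r) * g b.
  by rewrite [f (b * r)]gmulfM (efg r Ur) -mulTA -gmulfM -(efg _ Urb) -gmulfM
    mulgA brb.
(* [b * l] passes from [g] to [f], absorbs [b * r] there and passes back. *)
rewrite fb -{2}blb [g (b * l * b)]gmulfM mulTA -(efg _ Ubl) -gmulfM mulgA brb (efg _ Ubl).
by rewrite -gmulfM blb.
Qed.

(* The default value ord_max makes the lower adjoint total. *)
Definition lower_adj n (a : transf n.+1) : transf n.+1 :=
  [ffun y : 'I_n.+1 =>
    [arg min_(x < ord_max | (y <= a x)%N || (x == ord_max)) x]].

(* Meaningful only if a fixes the least point. *)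
Definition upper_adj n (a : transf n.+1) : transf n.+1 :=
  [ffun y : 'I_n.+1 => [arg max_(x > ord0 | (a x <= y)%N) x]].

Section Adjoints.
Variables (n : nat) (a : transf n.+1).
Hypothesis a_mono : order_preserving a.

Lemma lower_adj_le (x y : 'I_n.+1) : (y <= a x)%N -> (lower_adj a y <= x)%N.
Proof.
by rewrite ffunE; case: arg_minnP => [|z _ + yx]; rewrite ?eqxx ?orbT //;
  apply; rewrite yx.
Qed.

Lemma lower_adj_id (x : 'I_n.+1) : a (lower_adj a (a x)) = a x.
Proof.
have zx := lower_adj_le (leqnn (a x)); apply/val_inj/anti_leq.
rewrite (a_mono zx) /=; move: zx; rewrite ffunE.
case: arg_minnP => [|z /orP[//|/eqP-> _ mx]]; first by rewrite eqxx orbT.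
(* If the minimum is the default [ord_max], its bound by [x] forces [x = ord_max]. *)
by rewrite (_ : x = ord_max) //; apply/val_inj/anti_leq; rewrite mx leq_ord.
Qed.

Lemma lower_adj_mono : order_preserving (lower_adj a).
Proof.
move=> y y' yy'; rewrite [lower_adj a y']ffunE.
case: arg_minnP => [|z /orP[yz|/eqP-> _]]; first by rewrite eqxx orbT.
  by move=> _; apply/lower_adj_le/(leq_trans yy').
exact: leq_ord.
Qed.

Lemma lower_adj0 : lower_adj a ord0 = ord0.
Proof. by apply/val_inj/eqP; rewrite -leqn0 (@lower_adj_le ord0). Qed.

Hypothesis a0 : a ord0 = ord0.

Lemma upper_adjP (x y : 'I_n.+1) : (x <= upper_adj a y)%N = (a x <= y)%N.
Proof.
rewrite ffunE; case: arg_maxnP => [|z az maxz]; first by rewrite a0.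
by apply/idP/idP => [/a_mono/leq_trans->|/maxz].
Qed.

Lemma upper_adj_mono : order_preserving (upper_adj a).
Proof. by move=> y y' yy'; rewrite upper_adjP (leq_trans _ yy') // -upper_adjP. Qed.

Lemma upper_adj_id (x : 'I_n.+1) : a (upper_adj a (a x)) = a x.
Proof.
apply/val_inj/anti_leq; rewrite -upper_adjP leqnn.
by apply: a_mono; rewrite upper_adjP.
Qed.

Lemma dominion_extensive :
  (forall x : 'I_n.+1, (x <= a x)%N) -> dominion (@catalan n.+1) a.
Proof.
move=> a_ext; have ra y : (a (upper_adj a y) <= y)%N by rewrite -upper_adjP.
apply: (@dominion_zigzag _ _ a (lower_adj a) (upper_adj a)).
- split; [by move=> y; apply: lower_adj_le|exact: lower_adj_mono].
- split; [by move=> y; apply: leq_trans (ra y)|exact: upper_adj_mono].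
- split=> [x|x y xy]; rewrite !transf_mulE; first exact: lower_adj_le.
  exact/lower_adj_mono/a_mono.
- split=> [x|x y xy]; rewrite !transf_mulE //.
  exact/a_mono/upper_adj_mono.
- by apply/ffunP=> x; rewrite !transf_mulE lower_adj_id.
- by apply/ffunP=> x; rewrite !transf_mulE upper_adj_id.
Qed.

End Adjoints.

Lemma dominion_catalanP n (d : transf n.+1) :
  dominion (@catalan n.+1) d <-> order_preserving d /\ d ord0 = ord0.
Proof.
split=> [domd|[d_mono d0]].
  have u0 (u : transf n.+1) : catalan u -> u ord0 = ord0.
    by case=> u_decr _; apply/val_inj/eqP; rewrite -leqn0 (u_decr ord0).
  split; last first.
    apply: (@dominion_binop _ _ (fun _ _ => ord0) _ d domd ord0 ord0).
    by move=> u /u0 ? ? ?.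
  (* On a chain, preserving the minimum amounts to preserving the order. *)
  pose minI (x y : 'I_n.+1) := if (x <= y)%N then x else y.
  have minE (u : transf n.+1) : catalan u -> {morph u : x y / minI x y}.
    case=> _ u_mono x y; rewrite /minI; case: ifPn => [/u_mono->//|].
    rewrite -ltnNge => /ltnW/u_mono yx; case: ifP => // xy.
    by apply/val_inj/anti_leq; rewrite yx.
  move=> x y xy; have := dominion_binop minE domd x y.
  by rewrite /minI xy; case: (leqP (d x) (d y)) => [//|+ e]; rewrite e ltnn.
pose b : transf n.+1 := [ffun x : 'I_n.+1 => if (x <= d x)%N then d x else x].
pose c : transf n.+1 := [ffun x : 'I_n.+1 => if (x <= d x)%N then x else d x].
have -> : d = b * c.
  apply/ffunP=> x; rewrite transf_mulE /b /c !ffunE.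
  (* If [x <= d x], then [d x <= d (d x)], so [c] fixes [d x]. *)
  by case: (leqP x (d x)) => [/d_mono->|] //; rewrite ltnNge => /negPf->.
apply: dominionM.
  apply: dominion_extensive => [x y xy||x].
  - have := d_mono _ _ xy; rewrite !ffunE; do 2!case: ifPn => //; lia.
  - by rewrite ffunE d0.
  - by rewrite ffunE; case: ifP.
apply: sub_dominion; split=> [x|x y xy].
  by rewrite ffunE; case: ifPn => //; rewrite -ltnNge => /ltnW.
have := d_mono _ _ xy; rewrite !ffunE; do 2!case: ifPn => //; lia.
Qed.

Theorem mainTheorem10 (n : nat) (hn : (1 <= n)%N) :
  regular_subsemigroup (dominion (@catalan n)).
Proof.
case: n hn => // n _ a /dominion_catalanP[a_mono a0].
exists (lower_adj a).
  apply/dominion_catalanP; split; [exact: lower_adj_mono|exact: lower_adj0].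
by apply/ffunP=> x; rewrite !transf_mulE lower_adj_id.
Qed.
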